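(* Let $n\geq1$ and let $x_1>x_2>\cdots>x_n$ be nonzero integers. For a virtual knot diagram $K$ let $C_{(x_1,\dots,x_n)}$ be the set of $n$-tuples $(c_1,\dots,c_n)$ of chords of $G(K)$ with $\mathrm{Ind}(c_i)=x_i$ for all $i$, and set $$a_{(x_1,\dots,x_n)}(K)=\sum_{(c_1,\dots,c_n)\in C_{(x_1,\dots,x_n)}}\prod_{i=1}^n w(c_i).$$ Then $a_{(x_1,\dots,x_n)}$ is a virtual knot invariant and it is a finite type invariant of degree exactly $n$.
   Context: Virtual knot diagrams, real crossings with writhes $w(c)\in\{\pm1\}$, generalized Reidemeister moves ($\Omega_1,\Omega_2,\Omega_3$, virtual moves, mixed move $\Omega_3^v$). Gauss diagram $G(K)$: counterclockwise circle with, for each real crossing $c$, a chord directed from the overcrossing preimage to the undercrossing preimage, signed $w(c)$. A chord $d$ crosses $c$ if their endpoints interlace; viewing $c$ as an arrow in the disk, $d$ crosses $c$ from left to right if its tail is left of $c$ and head right of $c$, else from right to left. With $r_\pm(c), l_\pm(c)$ the numbers of chords of sign $\pm$ crossing $c$ from left to right, resp. right to left, $\mathrm{Ind}(c)=r_+(c)-r_-(c)-l_+(c)+l_-(c)$. Finite type invariants: a singular virtual knot diagram is a virtual knot diagram some of whose crossings are singular (transverse double points), considered up to generalized and singular Reidemeister moves. An invariant $f$ of virtual knots with values in an abelian group is extended to singular virtual knots by $f^{(0)}=f$ and $f^{(m)}(K)=f^{(m-1)}(K_+)-f^{(m-1)}(K_-)$, where $K_\pm$ resolves one singular crossing into a positive/negative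 crossing; equivalently for $K$ with singular crossings $c_1,\dots,c_m$, $f^{(m)}(K)=\sum_{\sigma\in\{0,1\}^m}(-1)^{|\sigma|}f(K_\sigma)$ where $K_\sigma$ resolves $c_i$ positively if $\sigma_i=0$ and negatively if $\sigma_i=1$. $f$ is a finite type invariant of degree $n$ if $f^{(n+1)}$ vanishes on all singular virtual knots with $n+1$ singular crossings, but $f^{(n)}(K)\neq0$ for some singular virtual knot $K$ with $n$ singular crossings. *)

(* Defs.v *)
(* Virtual knots are modelled by their Gauss diagrams
   (Goussarov-Polyak-Viro / Kauffman: virtual knots = Gauss diagrams modulo
   the Reidemeister moves on Gauss diagrams). *)
From Stdlib Require Import Relations.
From mathcomp Require Import all_boot all_order all_algebra.
Set Implicit Arguments. Unset Strict Implicit. Unset Printing Implicit Defensive.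
Import Order.TTheory GRing.Theory Num.Theory.

(* A Gauss diagram: the cyclic (counterclockwise = knot orientation) sequence
   of chord endpoints.  An endpoint is (label, over); over = true is the
   overcrossing preimage = tail of the chord, over = false the head.
   gsign l = true iff the real crossing l is positive. *)
Record gauss := Gauss { gword : seq (nat * bool); gsign : nat -> bool }.

Definition labels (D : gauss) : seq nat := undup [seq p.1 | p <- gword D].

Definition wf (D : gauss) : Prop :=
  uniq (gword D) /\ forall p, p \in gword D -> (p.1, ~~ p.2) \in gword D.

Definition wr (D : gauss) (c : nat) : int := if gsign D c then 1%R else (-1)%R.

Definition tailpos (D : gauss) (c : nat) := index (c, true) (gword D).
Definition headpos (D : gauss) (c : nat) := index (c, false) (gword D).

(* position k lies on the right of the arrow c: strictly inside the
   counterclockwise arc from the tail of c to its head *)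
Definition right_of (D : gauss) (c : nat) (k : nat) : bool :=
  let i := tailpos D c in let j := headpos D c in
  if (i < j)%N then (i < k < j)%N else (i < k)%N || (k < j)%N.

Definition crossesLR (D : gauss) (d c : nat) : bool :=
  ~~ right_of D c (tailpos D d) && right_of D c (headpos D d).
Definition crossesRL (D : gauss) (d c : nat) : bool :=
  right_of D c (tailpos D d) && ~~ right_of D c (headpos D d).

Definition r_plus (D : gauss) c := count (fun d => gsign D d && crossesLR D d c) (labels D).
Definition r_minus (D : gauss) c := count (fun d => ~~ gsign D d && crossesLR D d c) (labels D).
Definition l_plus (D : gauss) c := count (fun d => gsign D d && crossesRL D d c) (labels D).
Definition l_minus (D : gauss) c := count (fun d => ~~ gsign D d && crossesRL D d c) (labels D).

Definition Ind (D : gauss) (c : nat) : int :=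
  ((r_plus D c)%:Z - (r_minus D c)%:Z - (l_plus D c)%:Z + (l_minus D c)%:Z)%R.

Fixpoint seq_tuples (s : seq nat) (n : nat) : seq (seq nat) :=
  if n is n'.+1 then [seq c :: t | c <- s, t <- seq_tuples s n'] else [:: [::]].

Definition Cset (xs : seq int) (D : gauss) : seq (seq nat) :=
  [seq t <- seq_tuples (labels D) (size xs) | all2 (fun c x => Ind D c == x) t xs].

Definition a_inv (xs : seq int) (D : gauss) : int :=
  (\sum_(t <- Cset xs D) \prod_(c <- t) wr D c)%R.

Definition pm (b : bool) : int := if b then 1%R else (-1)%R.

Definition agree_on (D D' : gauss) : Prop :=
  forall l, l \in labels D -> gsign D' l = gsign D l.

Definition rot_move (D D' : gauss) : Prop :=
  exists k, gword D' = rot k (gword D) /\ gsign D' =1 gsign D.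

Definition relabel_move (D D' : gauss) : Prop :=
  exists f : nat -> nat, {in labels D &, injective f} /\
    gword D' = [seq (f p.1, p.2) | p <- gword D] /\
    forall l, l \in labels D -> gsign D' (f l) = gsign D l.

Definition R1_move (D D' : gauss) : Prop :=
  exists u v l b, gword D = u ++ v /\ l \notin labels D /\
    gword D' = u ++ [:: (l, b); (l, ~~ b)] ++ v /\ agree_on D D'.

(* Omega_2: two chords of opposite signs, one strand passing over the other
   twice (the two strands parallel or antiparallel) *)
Definition R2_move (D D' : gauss) : Prop :=
  exists u v w l m b (par : bool),
    gword D = u ++ v ++ w /\ l \notin labels D /\ m \notin labels D /\ l != m /\
    gsign D' l != gsign D' m /\ agree_on D D' /\
    gword D' = u ++ [:: (l, b); (m, b)] ++ v ++
              (if par then [:: (l, ~~ b); (m, ~~ b)] else [:: (m, ~~ b); (l, ~~ b)])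
              ++ w.

(* Omega_3: three strands top T, middle M, bottom B; chords
   al = T over M, be = T over B, ga = M over B.  The booleans oT oM oB give
   the order of the two endpoints on each strand; the move reverses the order
   on each of the three strands.  Such a configuration is realizable by three
   lines in the plane iff  w(al) w(be) = - eM eB  and  w(be) w(ga) = - eT eM,
   where eX = pm oX. *)
Definition fragT al be (oT : bool) : seq (nat * bool) :=
  if oT then [:: (al, true); (be, true)] else [:: (be, true); (al, true)].
Definition fragM al ga (oM : bool) : seq (nat * bool) :=
  if oM then [:: (ga, true); (al, false)] else [:: (al, false); (ga, true)].
Definition fragB be ga (oB : bool) : seq (nat * bool) :=
  if oB then [:: (be, false); (ga, false)] else [:: (ga, false); (be, false)].

Definition R3_move (D D' : gauss) : Prop :=
  exists u v w x (A B C : seq (nat * bool)) al be ga oT oM oB,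
    uniq [:: al; be; ga] /\
    perm_eq [:: A; B; C] [:: fragT al be oT; fragM al ga oM; fragB be ga oB] /\
    (wr D al * wr D be = - (pm oM * pm oB))%R /\
    (wr D be * wr D ga = - (pm oT * pm oM))%R /\
    gword D = u ++ A ++ v ++ B ++ w ++ C ++ x /\
    gword D' = u ++ rev A ++ v ++ rev B ++ w ++ rev C ++ x /\
    gsign D' =1 gsign D.

Definition gstep (D D' : gauss) : Prop :=
  wf D /\ wf D' /\
  (rot_move D D' \/ relabel_move D D' \/ R1_move D D' \/ R2_move D D' \/ R3_move D D').

Definition gequiv : relation gauss := clos_refl_sym_trans gauss gstep.

Definition virtual_invariant (f : gauss -> int) : Prop :=
  forall D D', gequiv D D' -> f D = f D'.

Definition flip (c : nat) (D : gauss) : gauss :=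
  Gauss [seq if p.1 == c then (c, ~~ p.2) else p | p <- gword D]
        (fun l => if l == c then ~~ gsign D l else gsign D l).

(* A singular virtual knot diagram with singular crossings S is represented by
   its all-positive resolution D (all chords of S positive in D).
   ext f D S = f^(|S|) of that singular diagram:
   f^(m)(K) = f^(m-1)(K_+) - f^(m-1)(K_-). *)
Fixpoint ext (f : gauss -> int) (D : gauss) (S : seq nat) : int :=
  match S with
  | [::] => f D
  | c :: S' => (ext f D S' - ext f (flip c D) S')%R
  end.

Definition singular (D : gauss) (S : seq nat) : Prop :=
  wf D /\ uniq S /\ {subset S <= labels D} /\ all (gsign D) S.

Definition finite_type_degree (f : gauss -> int) (n : nat) : Prop :=
  (forall D S, singular D S -> size S = n.+1 -> ext f D S = 0%R) /\
  (exists D S, singular D S /\ size S = n /\ ext f D S <> 0%R).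

(* Main.v *)
(* Give each endpoint the sign of its chord, negated at tails.  The signs along
   the arc on the right of a chord [c] add up to [Ind c], so [Ind c] is a
   difference of partial sums read off at the two ends of [c]; each move on
   Gauss diagrams changes these partial sums in a controlled way.  The
   invariant factors as the product over [i] of
   [J_x = sum of w(c) over Ind c = x] at [x = x_i].  Each [J_x] with [x <> 0]
   is invariant, since an isolated chord has index [0] and the two chords of
   an Omega_2 move have equal index and opposite sign.
   A crossing change at [c] preserves the sign of the endpoint at every position
   while exchanging the ends of [c]: it replaces [Ind c] by [- Ind c], fixes the
   other indices, and lowers [J_x] by an amount depending only on [|Ind c|].
   Hence the [m]-th extension is an iterated difference of a product of [n]
   affine functions: it vanishes for [m > n], and for [m = n] it is a permanent
   with nonnegative entries, which is positive as soon as the [i]-th singular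
   chord has index [x_i] up to sign. *)
Require Import Defs.
From mathcomp Require Import all_boot all_order all_algebra.
From mathcomp Require Import zify ring.
Import Order.TTheory GRing.Theory Num.Theory.
Set Implicit Arguments. Unset Strict Implicit. Unset Printing Implicit Defensive.
Local Open Scope ring_scope.

(** * Partial sums along a word *)

Section Potential.
Variable T : eqType.
Implicit Types (e : T -> int) (s u v : seq T) (p : T).

(** The partial sum strictly before the first occurrence of [p]; an absent [p] yields the full
    total. *)
Fixpoint pot e s p : int :=
  if s is q :: s' then if q == p then 0 else e q + pot e s' p else 0.

Lemma pot_notin e s p : p \notin s -> pot e s p = \sum_(q <- s) e q.
Proof.
elim: s => [|q s IHs] /=; first by rewrite big_nil.
by rewrite inE negb_or big_cons eq_sym => /andP[/negPf-> /IHs->].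
Qed.

Lemma pot_cat e u v p :
  pot e (u ++ v) p = if p \in u then pot e u p else \sum_(q <- u) e q + pot e v p.
Proof.
elim: u => [|q u IHu] /=; first by rewrite big_nil add0r.
rewrite inE big_cons eq_sym; case: eqP => //= _; rewrite IHu.
by case: ifP; rewrite ?addrA.
Qed.

Lemma eq_pot e e' s p : {in s, e =1 e'} -> pot e s p = pot e' s p.
Proof.
elim: s => //= q s IHs ee'; case: eqP => // _.
by rewrite ee' ?mem_head // IHs // => r rs; rewrite ee' // inE rs orbT.
Qed.

Lemma pot_index e s p : uniq s ->
  pot e s p = \sum_(q <- s) e q * (index q s < index p s)%N%:R.
Proof.
elim: s => [|q s IHs] /=; first by rewrite big_nil.
case/andP=> qs /IHs->; rewrite big_cons; case: (eqVneq q p) => [_|qp].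
  by rewrite mulr0 add0r big1 // => r _; rewrite mulr0.
rewrite eqxx ltn0Sn mulr1; congr (_ + _); apply: eq_big_seq => r rs.
by case: eqP rs qs => [->->|].
Qed.

(* Away from [s], both inner potentials equal the total of [s]. *)
Lemma pot_rev e u s v p : uniq (u ++ s ++ v) ->
  pot e (u ++ rev s ++ v) p =
  pot e (u ++ s ++ v) p + (pot e (rev s) p - pot e s p).
Proof.
rewrite cat_uniq => /and3P[_ /hasPn dis _].
have tot: \sum_(q <- rev s) e q = \sum_(q <- s) e q.
  by apply: perm_big; rewrite perm_rev.
rewrite !pot_cat tot mem_rev; case: (boolP (p \in s)) => ps.
  have /negPf->: p \notin u by apply: dis; rewrite mem_cat ps.
  by ring.
rewrite !(pot_notin _ ps) (@pot_notin _ (rev s)) ?mem_rev // tot.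
by case: ifP => _; ring.
Qed.

End Potential.

Lemma pot_map (T T' : eqType) (f : T -> T') (e' : T' -> int) (s : seq T) (p : T) :
    {in s, forall q, f q = f p -> q = p} ->
  pot e' (map f s) (f p) = pot (e' \o f) s p.
Proof.
elim: s => //= q s IHs fK.
have ->: (f q == f p) = (q == p).
  by apply/eqP/eqP => [/fK->//|->//]; rewrite mem_head.
by case: eqP => // _; rewrite IHs // => r rs; apply: fK; rewrite inE rs orbT.
Qed.

(** * Indices as differences of partial sums *)

(* The contribution of an endpoint to the index of a chord having it on its
   right. *)
Definition esign (D : gauss) (p : nat * bool) : int :=
  wr D p.1 * (if p.2 then -1 else 1).

Definition gpot (D : gauss) (p : nat * bool) : int :=
  pot (esign D) (gword D) p.

Lemma esignN D c b : esign D (c, ~~ b) = - esign D (c, b).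
Proof. by rewrite /esign /=; case: b => /=; ring. Qed.

Lemma labels_uniq D : uniq (labels D).
Proof. exact: undup_uniq. Qed.

Lemma mem_labels D c : (c \in labels D) = (c \in [seq p.1 | p <- gword D]).
Proof. exact: mem_undup. Qed.

Lemma mem_gword D c b : wf D -> ((c, b) \in gword D) = (c \in labels D).
Proof.
case=> _ wfD; rewrite mem_labels; apply/idP/mapP => [cb|]; first by exists (c, b).
case=> -[c' b'] cb' /= ->; case: (eqVneq b' b) => [<-//|]; have := wfD _ cb'.
by case: b b' {cb'} => -[].
Qed.

Lemma big_gword D (g : nat * bool -> int) : wf D ->
  \sum_(p <- gword D) g p = \sum_(c <- labels D) (g (c, true) + g (c, false)).
Proof.
move=> wfD; rewrite (perm_big [seq (c, b) | c <- labels D, b <- [:: true; false]]).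
  rewrite big_allpairs_dep; apply: eq_bigr => c _.
  by rewrite !big_cons big_nil /= addr0.
apply: uniq_perm; first by case: wfD.
  by apply: allpairs_uniq; rewrite ?labels_uniq // => -[? ?] [? ?].
move=> [c b]; rewrite mem_gword //; apply/idP/allpairsP => [cD|].
  by exists (c, b); split=> //; case: (b).
by case=> -[c' b'] /= [cD _ [-> _]].
Qed.

Lemma esign_total D : wf D -> \sum_(p <- gword D) esign D p = 0.
Proof.
move=> wfD; rewrite big_gword // big1_seq // => c _.
by rewrite -[false]/(~~ true) esignN subrr.
Qed.

(** The two endpoints of a chord [d] have opposite signs, so they cancel unless exactly one lies on
    the right of [c]; what is left is [wr D d] or its negative, according to the direction of
    crossing. *)
Lemma Ind_sum D c : wf D ->
  Ind D c = \sum_(p <- gword D)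
    esign D p * (right_of D c (index p (gword D)))%:R.
Proof.
move=> wfD; rewrite big_gword // /Ind /r_plus /r_minus /l_plus /l_minus.
elim: (labels D) => [|d s IHs]; first by rewrite big_nil.
rewrite big_cons -{}IHs /= !PoszD /crossesLR /crossesRL /esign /wr /=.
rewrite -/(tailpos D d) -/(headpos D d).
by case: (gsign D d) (right_of _ _ _) (right_of _ _ _) => -[] [] /=; lia.
Qed.

(** The difference of potentials also counts the tail of [c], which the open right arc omits; adding
    [wr D c] removes it. *)
Lemma Ind_gpot D c : wf D -> c \in labels D ->
  Ind D c = gpot D (c, false) - gpot D (c, true) + wr D c.
Proof.
move=> wfD cD; have uD : uniq (gword D) by case: wfD.
have tD: (c, true) \in gword D by rewrite mem_gword.
have hD: (c, false) \in gword D by rewrite mem_gword.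
have Et: \sum_(q <- gword D) esign D q * (index q (gword D) == tailpos D c)%N%:R
   = - wr D c.
  rewrite (bigD1_seq (c, true)) //= eqxx mulr1 big1_seq ?addr0 /esign /=.
    by rewrite mulrN1.
  move=> q /andP[qc qD]; rewrite /tailpos; case: eqP => [/(index_inj q qD tD) E|].
    by rewrite E eqxx in qc.
  by rewrite mulr0.
rewrite -[wr D c]opprK -Et Ind_sum // /gpot !pot_index // -!sumrB.
have neq: tailpos D c != headpos D c.
  by apply/eqP => /(index_inj (c, true) tD hD).
rewrite /right_of -/(tailpos D c) -/(headpos D c).
(* When the right arc wraps around the base point, the total sum, which is zero, is added once. *)
case: ltnP => th; last rewrite -[RHS]addr0 -[X in _ = _ + X](esign_total wfD) -big_split /=.
  apply: eq_bigr => q _; rewrite -!mulrBr; congr (_ * _).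
  by case: (ltngtP (index q _) (tailpos D c)); case: (ltnP _ (headpos D c)) => //=; lia.
apply: eq_bigr => q _; rewrite -!mulrBr -[X in _ + X]mulr1 -mulrDr; congr (_ * _).
by case: (ltngtP (index q _) (tailpos D c)); case: (ltnP _ (headpos D c)) => //=; lia.
Qed.

(** * Writhes of fixed index and the factorization of the invariant *)

Definition writhe_at (x : int) (D : gauss) : int :=
  \sum_(c <- labels D | Ind D c == x) wr D c.

Lemma a_inv_prod xs D : a_inv xs D = \prod_(x <- xs) writhe_at x D.
Proof.
rewrite /a_inv /Cset big_filter.
elim: xs => [|x xs IHxs] /=; first by rewrite big_cons !big_nil addr0.
rewrite big_cons -{}IHxs big_mkcond big_allpairs_dep /writhe_at mulr_suml.
rewrite [RHS]big_mkcond.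
apply: eq_bigr => c _; rewrite -big_mkcond mulr_sumr /=.
case: eqP => _ /=; last by rewrite big_pred0.
by apply: eq_bigr => t _; rewrite big_cons.
Qed.

(** Common form of the moves: [f] transports the old chords and [s] lists the created ones. *)
Lemma writhe_at_cat (f : nat -> nat) s x D D' :
    perm_eq (labels D') (s ++ map f (labels D)) ->
    {in labels D, forall c, Ind D' (f c) = Ind D c /\ wr D' (f c) = wr D c} ->
  writhe_at x D' = \sum_(c <- s | Ind D' c == x) wr D' c + writhe_at x D.
Proof.
move=> DD' H; rewrite /writhe_at (perm_big _ DD') big_cat big_map /=.
congr (_ + _); rewrite [LHS]big_seq_cond [RHS]big_seq_cond.
apply: eq_big => [c|c]; first by case: (boolP (c \in _)) => //= /H[-> _].
by case/andP=> /H[_ ->].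
Qed.

Lemma eq_writhe_at (f : nat -> nat) x D D' :
    perm_eq (labels D') (map f (labels D)) ->
    {in labels D, forall c, Ind D' (f c) = Ind D c /\ wr D' (f c) = wr D c} ->
  writhe_at x D' = writhe_at x D.
Proof.
by move=> DD' H; rewrite (writhe_at_cat (f := f) (s := [::]) _ DD' H) big_nil add0r.
Qed.

Lemma perm_labels D D' : perm_eq (gword D') (gword D) ->
  perm_eq (labels D') (labels D).
Proof.
move=> DD'; apply: uniq_perm; rewrite ?labels_uniq // => c.
by rewrite !mem_labels; apply: perm_mem; apply: perm_map.
Qed.

(** * Invariance under the moves on Gauss diagrams *)

Lemma eq_gsign D D' : gsign D' =1 gsign D ->
  wr D' =1 wr D /\ esign D' =1 esign D.
Proof. by move=> E; split=> p; rewrite /esign /wr E. Qed.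

Lemma rot_writhe_at x D D' : wf D -> wf D' -> rot_move D D' ->
  writhe_at x D' = writhe_at x D.
Proof.
move=> wfD wfD' [k [wD' /eq_gsign[Ew Ee]]].
have pD: perm_eq (labels D') (labels D).
  by apply: perm_labels; rewrite wD' perm_rot.
apply: (eq_writhe_at (f := id)) => [|c cD]; first by rewrite map_id.
split=> //; rewrite !Ind_gpot // ?(perm_mem pD) // Ew; congr (_ + _).
(* Moving the base point shifts all potentials by one constant, because the total sum is zero. *)
suff shift b : gpot D' (c, b) =
    gpot D (c, b) - \sum_(q <- take k (gword D)) esign D q.
  by rewrite !shift; ring.
have cb: (c, b) \in gword D by rewrite mem_gword.
have:= esign_total wfD; case: wfD => uD _.
move: uD cb; rewrite /gpot (eq_pot (e' := esign D)) => [|p _]; last exact: Ee.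
rewrite wD' /rot -{1 2 3 6}(cat_take_drop k (gword D)) !pot_cat big_cat /=.
rewrite cat_uniq mem_cat => /and3P[_ /hasPn dis _] cb.
case: (boolP (_ \in drop k _)) => [/dis/= /negPf->|cd]; first by move=> _; ring.
by move: cb; rewrite (negPf cd) orbF => -> /addr0_eq ->; rewrite addrC.
Qed.

Lemma relabel_writhe_at x D D' : wf D -> wf D' -> relabel_move D D' ->
  writhe_at x D' = writhe_at x D.
Proof.
move=> wfD wfD' [f [fI [wD' sD']]].
have pD: perm_eq (labels D') (map f (labels D)).
  apply: uniq_perm; rewrite ?labels_uniq ?map_inj_in_uniq ?labels_uniq // => c.
  rewrite mem_labels wD' -map_comp.
  apply/mapP/mapP => [[p pD ->]|[d]]; first by exists p.1; rewrite ?mem_labels ?map_f.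
  by rewrite mem_labels => /mapP[p pD ->] ->; exists p.
have wrE c : c \in labels D -> wr D' (f c) = wr D c.
  by move=> cD; rewrite /wr sD'.
apply: (eq_writhe_at (f := f)) => [//|c cD]; split; last exact: wrE.
rewrite !Ind_gpot // ?(perm_mem pD) ?map_f // wrE //; congr (_ + _).
have lD p : p \in gword D -> p.1 \in labels D by move=> pD'; rewrite mem_labels map_f.
suff gE b : gpot D' (f c, b) = gpot D (c, b) by rewrite !gE.
rewrite /gpot wD' (@pot_map _ _ (fun p => (f p.1, p.2)) _ _ (c, b)) /=.
  by apply: eq_pot => p pD' /=; rewrite /esign /= wrE // lD.
by move=> [d b'] /lD/= dD [/fI-> // ->].
Qed.

Lemma R1_writhe_at x D D' : x != 0 -> wf D -> wf D' -> R1_move D D' ->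
  writhe_at x D' = writhe_at x D.
Proof.
move=> x0 wfD wfD' [u [v [l [b [wD [lD [wD' sD']]]]]]].
have lbD b': (l, b') \notin u ++ v by rewrite -wD mem_gword.
have pD: perm_eq (labels D') (l :: labels D).
  apply: uniq_perm; rewrite ?labels_uniq //= ?lD ?labels_uniq // => c.
  rewrite inE !mem_labels wD wD' !map_cat !mem_cat /= !inE.
  by rewrite orbCA; case: (c == l).
have wrE c : c \in labels D -> wr D' c = wr D c by move=> cD; rewrite /wr sD'.
have eE: {in gword D, esign D' =1 esign D}.
  by move=> [c b'] cD; rewrite /esign wrE //= -(mem_gword c b').
(* The inserted endpoints cancel, so potentials at old endpoints do not change. *)
have lb_sum : \sum_(q <- [:: (l, b); (l, ~~ b)]) esign D' q = 0.
  by rewrite !big_cons big_nil esignN /= addr0 subrr.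
have gE c b' : c \in labels D -> gpot D' (c, b') = gpot D (c, b').
  move=> cD; have/negPf cl: c != l by apply: contraNneq lD => <-.
  rewrite /gpot wD' -(eq_pot (c, b') eE) wD !pot_cat lb_sum !inE !xpair_eqE cl /=.
  by rewrite add0r.
have lI: Ind D' l = 0.
  rewrite Ind_gpot ?(perm_mem pD) ?mem_head // /gpot wD' !pot_cat /=.
  have nu b' : ((l, b') \in u) = false.
    by have:= lbD b'; rewrite mem_cat negb_or => /andP[/negPf].
  rewrite !nu !inE !xpair_eqE !eqxx /= /esign /=.
  by case: (b) => /=; ring.
rewrite (@writhe_at_cat id [:: l] x D D') ?map_id //.
  by rewrite big_cons lI eq_sym (negPf x0) big_nil add0r.
move=> c cD; rewrite !Ind_gpot ?(perm_mem pD) ?inE ?cD ?orbT // !gE // wrE //.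
Qed.

Lemma R2_writhe_at x D D' : wf D -> wf D' -> R2_move D D' ->
  writhe_at x D' = writhe_at x D.
Proof.
move=> wfD wfD'.
case=> u [v [w [l [m [b [par]]]]]] [wD [lD [mD [lm [slm [sD' wD']]]]]].
set Y := if par then _ else _ in wD'.
have Ymem p : (p \in Y) = (p \in [:: (l, ~~ b); (m, ~~ b)]).
  by rewrite /Y; case: par {Y wD'}; rewrite !inE // orbC.
have fresh c b' : c \notin labels D ->
    [/\ ((c, b') \in u) = false, ((c, b') \in v) = false
      & ((c, b') \in w) = false].
  rewrite -(mem_gword c b' wfD) wD !mem_cat !negb_or => /and3P[*].
  by split; apply: negbTE.
have pD: perm_eq (labels D') ([:: l; m] ++ labels D).
  apply: uniq_perm; rewrite ?labels_uniq //= ?inE ?negb_or ?lm ?lD ?mD ?labels_uniq // => c.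
  rewrite !inE -(mem_gword c b wfD) -(mem_gword c b wfD') wD wD' !mem_cat Ymem !inE.
  rewrite !xpair_eqE eqxx; case: (b); rewrite /= !(andbT, andbF) /=;
  by do ![case: (_ == _) | case: (_ \in _)].
have wrE c : c \in labels D -> wr D' c = wr D c by move=> cD; rewrite /wr sD'.
have eE: {in gword D, esign D' =1 esign D}.
  by move=> [c b'] cD; rewrite /esign wrE //= -(mem_gword c b').
have wrm: wr D' m = - wr D' l.
  by move: slm; rewrite /wr; case: (gsign D' l) (gsign D' m) => -[].
have em b' : esign D' (m, b') = - esign D' (l, b').
  by rewrite /esign /= wrm mulNr.
have X0 : \sum_(q <- [:: (l, b); (m, b)]) esign D' q = 0.
  by rewrite !big_cons big_nil em addr0 subrr.
have Y0 : \sum_(q <- Y) esign D' q = 0.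
  by rewrite /Y; case: (par); rewrite !big_cons big_nil em addr0 ?subrr ?addNr.
have gE c b' : c \in labels D -> gpot D' (c, b') = gpot D (c, b').
  move=> cD; have/negPf cl: c != l by apply: contraNneq lD => <-.
  have/negPf cm: c != m by apply: contraNneq mD => <-.
  rewrite /gpot wD' -(eq_pot (c, b') eE) wD !pot_cat X0 Y0 Ymem !inE.
  by rewrite !xpair_eqE cl cm /= !add0r.
(* Equal indices put both new chords in the same writhe, where their opposite signs cancel. *)
have lmI: Ind D' l = Ind D' m.
  rewrite !Ind_gpot ?(perm_mem pD) ?inE ?eqxx ?orbT //.
  rewrite /gpot wD' !pot_cat X0 !Ymem !inE !xpair_eqE !eqxx.
  have [[lt lt' _] [lf lf' _]] := (fresh l true lD, fresh l false lD).
  have [[mt mt' _] [mf mf' _]] := (fresh m true mD, fresh m false mD).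
  rewrite lt lf mt mf lt' lf' mt' mf' /Y.
  have /negPf ml: m != l by rewrite eq_sym.
  have /negPf lm' := lm.
  by case: (par) (b) => -[]; rewrite /= ?xpair_eqE ?eqxx ?ml ?lm' /= ?em wrm
    /esign /=; ring.
rewrite (@writhe_at_cat id [:: l; m] x D D') ?map_id //.
  by rewrite !big_cons big_nil lmI wrm; case: (Ind D' m == x); ring.
move=> c cD; rewrite !Ind_gpot ?(perm_mem pD) ?inE ?cD ?orbT // !gE // wrE //.
Qed.

Lemma R3_writhe_at x D D' : wf D -> wf D' -> R3_move D D' ->
  writhe_at x D' = writhe_at x D.
Proof.
move=> wfD wfD'.
case=> u [v [w [y [A [B [C [al [be [ga [oT [oM [oB]]]]]]]]]]]].
case=> dist [pABC [sMB [sTM [wD [wD' /eq_gsign[Ew Ee]]]]]].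
have pg: perm_eq (gword D') (gword D).
  by rewrite wD wD'; do !rewrite ?perm_cat2l perm_cat ?perm_rev //.
have pD := perm_labels pg.
(* Reversing a fragment alters potentials only at its own endpoints, so the three changes add up. *)
pose sh p := \sum_(X <- [:: fragT al be oT; fragM al ga oM; fragB be ga oB])
  (pot (esign D) (rev X) p - pot (esign D) X p).
have gE p : gpot D' p = gpot D p + sh p.
  rewrite /gpot (eq_pot (e' := esign D)) => [|q _]; last exact: Ee.
  rewrite /sh -(perm_big _ pABC) !big_cons big_nil /= addr0.
  have: uniq (gword D') by case: wfD'.
  have rev_mid (s1 s2 s3 : seq (nat * bool)) :
      uniq (s1 ++ rev s2 ++ s3) = uniq (s1 ++ s2 ++ s3).
    by apply: perm_uniq; rewrite perm_cat2l perm_cat2r perm_rev.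
  rewrite wD wD' rev_mid => uA; rewrite pot_rev //.
  move: uA; rewrite !(catA A) !(catA u) rev_mid => uB; rewrite pot_rev //.
  move: uB; rewrite !(catA B) !(catA (_ ++ v)) rev_mid => uC; rewrite pot_rev //.
  by ring.
apply: (eq_writhe_at (f := id)) => [|c cD]; first by rewrite map_id.
split=> //; rewrite !Ind_gpot // ?(perm_mem pD) // Ew !gE; congr (_ + _).
(* Both ends of a chord shift equally. The second sign condition gives this for [al], the first for
   [ga], and their product for [be]. *)
suff: sh (c, false) = sh (c, true) by move->; ring.
move: dist sMB sTM; rewrite /= !inE negb_or => /and3P[/andP[ab ag] bg _].
have /negPf ba : be != al by rewrite eq_sym.
have /negPf ga' : ga != al by rewrite eq_sym.
have /negPf gb : ga != be by rewrite eq_sym.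
move/negPf: ab ag bg => ab /negPf ag /negPf bg.
rewrite /sh !big_cons !big_nil /wr /fragT /fragM /fragB.
have [<-|/negPf ac] := eqVneq al c; last have [<-|/negPf bc] := eqVneq be c;
  last have [<-|/negPf gc] := eqVneq ga c;
  case: oT oM oB {pABC sh gE} => -[] []; rewrite /rev /= !xpair_eqE ?eqxx
    ?ab ?ag ?ba ?bg ?ga' ?gb ?ac ?bc ?gc /= /esign /wr /=;
  by case: (gsign D al) (gsign D be) (gsign D ga) => -[] [].
Qed.

Lemma step_writhe_at x D D' : x != 0 -> gstep D D' ->
  writhe_at x D' = writhe_at x D.
Proof.
move=> x0 [wfD [wfD']] [|[|[|[|]]]].
- exact: rot_writhe_at.
- exact: relabel_writhe_at.
- exact: R1_writhe_at.
- exact: R2_writhe_at.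
- exact: R3_writhe_at.
Qed.

Lemma a_inv_invariant xs : all (fun x => x != 0) xs ->
  virtual_invariant (a_inv xs).
Proof.
move=> xs0 D D'; elim=> {D D'} [D D' step|//|//|D1 D2 D3 _ -> _ ->//].
rewrite !a_inv_prod; apply: eq_big_seq => x /(allP xs0) x0.
by rewrite (step_writhe_at x0 step).
Qed.

(** * Effect of a crossing change *)

Lemma labels_flip c D : labels (flip c D) = labels D.
Proof.
rewrite /labels /= -map_comp; congr undup; apply: eq_map => p /=.
by case: eqP.
Qed.

Lemma flip_endpointK c :
  involutive (fun p : nat * bool => if p.1 == c then (c, ~~ p.2) else p).
Proof.
by move=> [d b] /=; case: (eqVneq d c) => [->|/negPf dc] /=; rewrite ?eqxx ?dc ?negbK.
Qed.

Lemma wf_flip c D : wf D -> wf (flip c D).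
Proof.
have fK := flip_endpointK c; case=> uD wfD; split=> /=.
  by rewrite map_inj_uniq //; apply: inv_inj.
move=> p /mapP[[d b] /wfD /= dD ->]; apply/mapP; exists (d, ~~ b) => //=.
by case: eqP.
Qed.

(* Reversing a chord together with its sign leaves the sign of the endpoint at
   every position unchanged. *)
Lemma Ind_flip c d D : wf D -> d \in labels D ->
  Ind (flip c D) d = if d == c then - Ind D d else Ind D d.
Proof.
move=> wfD dD; rewrite !Ind_gpot ?labels_flip //; last exact: wf_flip.
have gE b : gpot (flip c D) (if d == c then (c, ~~ b) else (d, b)) = gpot D (d, b).
  pose f (p : nat * bool) := if p.1 == c then (c, ~~ p.2) else p.
  rewrite /gpot (_ : gword (flip c D) = map f (gword D)) //.
  rewrite -[X in pot _ _ X]/(f (d, b)) pot_map; last first.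
    by move=> q _; apply: inv_inj (flip_endpointK c) _ _.
  apply: eq_pot => -[a b'] _; rewrite /= /f /esign /wr /=.
  case: (eqVneq a c) => [->|/negPf ac] /=; rewrite ?eqxx ?ac //=.
  by case: (gsign D c) b' => -[].
have [gT gF] := (gE true, gE false); move: gT gF; rewrite /wr /=.
by case: (eqVneq d c) => [->|dc] /= -> ->; case: gsign => /=; ring.
Qed.

(* The jump of [writhe_at x] across a positive chord of index [k]. *)
Definition jump (k x : int) : int := (k == x)%:R + (- k == x)%:R.

Lemma jumpN k x : jump (- k) x = jump k x.
Proof. by rewrite /jump opprK addrC. Qed.

(** The chord leaves index [Ind D c] with sign 1 and enters the opposite index with sign -1; either
    event lowers the writhe there by 1. *)
Lemma writhe_at_flip c x D : wf D -> c \in labels D -> gsign D c ->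
  writhe_at x (flip c D) = writhe_at x D - jump (Ind D c) x.
Proof.
move=> wfD cD sc; rewrite /writhe_at labels_flip !(big_mkcond (fun d => _ == x)).
rewrite !(bigD1_seq c) ?labels_uniq //= Ind_flip // eqxx /wr /= eqxx sc /=.
rewrite [X in _ + X](_ : _ = \sum_(i <- labels D | i != c)
    (if Ind D i == x then wr D i else 0)).
  by rewrite /jump /wr; case: (_ == x) (_ == x) => -[] /=; ring.
rewrite [LHS]big_seq_cond [RHS]big_seq_cond.
apply: eq_bigr => d /andP[dD /negPf dc].
by rewrite Ind_flip // dc /wr.
Qed.

(** * Iterated differences of a product of affine functions *)

Section IteratedDifference.
Variables (X : eqType) (C : Type) (delta : C -> X -> int).
Implicit Types (l : seq (int * X)) (c : C) (S : seq C).

Definition shift c l := [seq (p.1 - delta c p.2, p.2) | p <- l].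

(* The iterated difference along [S] of a product of functions, the factor
   [p] taking the value [p.1] and dropping by [delta c p.2] when [c] is
   flipped. *)
Fixpoint prod_diff l S : int :=
  if S is c :: S' then prod_diff l S' - prod_diff (shift c l) S'
  else \prod_(p <- l) p.1.

(** The product is affine in each factor, with slope the product of the others; taking differences
    preserves this. *)
Lemma prod_diffD l1 l2 a b x S :
  prod_diff (l1 ++ (a + b, x) :: l2) S =
  b * prod_diff (l1 ++ l2) S + prod_diff (l1 ++ (a, x) :: l2) S.
Proof.
elim: S l1 l2 a => [|c S IHS] l1 l2 a /=.
  by rewrite !big_cat !big_cons /=; ring.
rewrite /shift !map_cat /= IHS [a + b - _]addrAC IHS; ring.
Qed.

(** Telescoping: factors are shifted one at a time, [l1] holding those left fixed or already
    shifted. Each term of [r] records a deleted factor and the remaining list. *)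
Lemma prod_diff_shift c l1 l2 S :
  exists2 r : seq (X * seq (int * X)),
    all (fun q => (size q.2).+1 == size (l1 ++ l2)) r &
    prod_diff (l1 ++ l2) S - prod_diff (l1 ++ shift c l2) S =
    \sum_(q <- r) delta c q.1 * prod_diff q.2 S.
Proof.
elim: l2 l1 => [|[a x] l2 IHl] l1.
  by exists [::] => //=; rewrite big_nil subrr.
have [r szr Er] := IHl (rcons l1 (a - delta c x, x)).
exists ((x, l1 ++ l2) :: r).
  rewrite /= !size_cat /= addnS eqxx; apply: sub_all szr => q.
  by rewrite size_cat size_rcons addSn.
rewrite big_cons -Er !cat_rcons /= -{1}[a](subrK (delta c x)) prod_diffD.
by ring.
Qed.

(** Each difference uses up one factor, so the factors run out before the chords. *)
Lemma prod_diff_eq0 l S : (size l < size S)%N -> prod_diff l S = 0.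
Proof.
elim: S l => //= c S IHS l; rewrite ltnS => lS.
have [r /allP szr ->] := prod_diff_shift c [::] l S.
apply: big1_seq => q /andP[_ /szr/eqP szq].
by rewrite IHS ?mulr0 // (leq_trans _ lS) // -szq.
Qed.

Hypothesis delta_ge0 : forall c x, 0 <= delta c x.

Lemma prod_diff_ge0 l S : size l = size S -> 0 <= prod_diff l S.
Proof.
elim: S l => [|c S IHS] [|p l] //= => [_|[lS]]; first by rewrite big_nil.
have [r /allP szr ->] := prod_diff_shift c [::] (p :: l) S.
rewrite big_seq; apply: sumr_ge0 => q /szr/eqP [szq].
by rewrite mulr_ge0 // IHS // szq.
Qed.

Lemma prod_diff_gt0 l S :
  all2 (fun p c => 0 < delta c p.2) l S -> 0 < prod_diff l S.
Proof.
elim: S l => [|c S IHS] [|[a x] l] //=; first by rewrite big_nil.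
case/andP=> dx lS; have szl: size l = size S.
  by move: lS; rewrite all2E => /andP[/eqP].
have [r /allP szr Er] := prod_diff_shift c [:: (a - delta c x, x)] l S.
(* Splitting off the first factor isolates the diagonal term of the permanent; the other terms are
   nonnegative. *)
rewrite -{1}[a](subrK (delta c x)) (prod_diffD [::]) /= -addrA.
rewrite ltr_wpDr ?mulr_gt0 ?IHS // Er big_seq.
apply: sumr_ge0 => q /szr/eqP [szq].
by rewrite mulr_ge0 // prod_diff_ge0 // szq.
Qed.

End IteratedDifference.

(** A single [delta] serves every resolution: a crossing change preserves indices up to sign, and
    [jump] is even in the index. *)
Lemma ext_a_inv (delta : nat -> int -> int) xs D S :
    wf D -> uniq S -> {subset S <= labels D} -> all (gsign D) S ->
    {in S, forall c x, delta c x = jump (Ind D c) x} ->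
  ext (a_inv xs) D S = prod_diff delta [seq (writhe_at x D, x) | x <- xs] S.
Proof.
elim: S D => [|c S IHS] D wfD /=; first by rewrite a_inv_prod big_map.
case/andP=> cS uS SD /andP[sc sS] dE.
have cD : c \in labels D by rewrite SD ?mem_head.
have{}SD : {subset S <= labels D} by move=> d dS; rewrite SD // inE dS orbT.
rewrite !IHS ?labels_flip //; first last.
- by move=> d dS x; rewrite dE // inE dS orbT.
- move=> d dS x; rewrite dE ?inE ?dS ?orbT // Ind_flip ?SD //.
  by case: eqP => // _; rewrite jumpN.
- apply/allP => d dS /=; rewrite (allP sS) //.
  by case: eqP dS cS => // -> ->.
- exact: wf_flip.
congr (_ - prod_diff _ _ _); rewrite /shift -map_comp; apply: eq_map => x /=.
by rewrite writhe_at_flip // dE ?mem_head.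
Qed.

(** * Diagrams with prescribed indices *)

(* In a block of [n] parallel positive chords, whose tails and heads occur in
   the same order, the [i]-th chord has index [2 * i + 1 - n]; hence the first
   chord of a block of size [k.+1] has index [- k]. *)
Fixpoint blocks (b : nat) (ks : seq nat) : seq (nat * bool) :=
  if ks is k :: ks' then
    [seq (j, true) | j <- iota b k.+1] ++ [seq (j, false) | j <- iota b k.+1] ++
    blocks (b + k.+1) ks'
  else [::].

Lemma blocks_cons b k ks :
  blocks b (k :: ks) =
    [seq (j, true) | j <- iota b k.+1] ++ [seq (j, false) | j <- iota b k.+1] ++
    blocks (b + k.+1) ks.
Proof. by []. Qed.

(** Labels of the first chord of each block, not arrowheads. *)
Fixpoint block_heads (b : nat) (ks : seq nat) : seq nat :=
  if ks is k :: ks' then b :: block_heads (b + k.+1) ks' else [::].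

Definition block_diagram ks := Gauss (blocks 0 ks) (fun=> true).

Lemma mem_seq_pair (s : seq nat) (j : nat) (t t' : bool) :
  ((j, t) \in [seq (i, t') | i <- s]) = (t == t') && (j \in s).
Proof.
by apply/mapP/andP => [[i is_ [-> ->]]|[/eqP-> js]]; [rewrite eqxx | exists j].
Qed.

Lemma mem_blocks b ks j t :
  ((j, t) \in blocks b ks) = (b <= j < b + sumn (map S ks))%N.
Proof.
elim: ks b => [|k ks IHks] b; first by rewrite /= in_nil; lia.
rewrite blocks_cons !mem_cat !mem_seq_pair IHks mem_iota /=.
by case: t {IHks} => /=; lia.
Qed.

Lemma blocks_uniq b ks : uniq (blocks b ks).
Proof.
elim: ks b => // k ks IHks b; rewrite blocks_cons !cat_uniq IHks.
rewrite !map_inj_uniq ?iota_uniq => [|i i' []//|i i' []//].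
rewrite andbT; apply/and3P; split=> //; apply/hasPn => -[j t].
  rewrite mem_cat !mem_seq_pair mem_blocks mem_iota.
  by case: t => /=; rewrite ?negb_and; lia.
by rewrite mem_blocks mem_seq_pair mem_iota; lia.
Qed.

Lemma block_headsP b ks c : c \in block_heads b ks ->
  (b <= c < b + sumn (map S ks))%N.
Proof.
elim: ks b => //= k ks IHks b; rewrite inE => /predU1P[->|/IHks]; lia.
Qed.

Lemma block_heads_uniq b ks : uniq (block_heads b ks).
Proof.
elim: ks b => //= k ks IHks b; rewrite IHks andbT.
by apply/negP => /block_headsP; lia.
Qed.

Lemma size_block_heads b ks : size (block_heads b ks) = size ks.
Proof. by elim: ks b => //= k ks IHks b; rewrite IHks. Qed.

Lemma mem_zip_heads b ks p : p \in zip ks (block_heads b ks) ->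
  p.2 \in block_heads b ks.
Proof.
move=> pz; rewrite -[block_heads b ks](unzip2_zip (s := ks)) ?map_f //.
by rewrite size_block_heads.
Qed.

(** Earlier blocks have total zero. Within its block, the first chord has nothing before its tail
    and [k.+1] tails before its head. *)
Lemma blocks_pot (e : nat * bool -> int) b ks :
    (forall p, e p = if p.2 then -1 else 1) ->
  forall k c, (k, c) \in zip ks (block_heads b ks) ->
    pot e (blocks b ks) (c, false) - pot e (blocks b ks) (c, true) + 1 = - k%:Z.
Proof.
move=> eE; elim: ks b => // k ks IHks b k' c.
have tails n : \sum_(p <- [seq (j, true) | j <- iota b n]) e p = - n%:Z.
  rewrite big_map (eq_bigr (fun=> -1)) => [|j _]; last by rewrite eE.
  by rewrite big_const_seq count_predT size_iota iter_addr addr0 mulNrn natz.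
have heads n : \sum_(p <- [seq (j, false) | j <- iota b n]) e p = n%:Z.
  rewrite big_map (eq_bigr (fun=> 1)) => [|j _]; last by rewrite eE.
  by rewrite big_const_seq count_predT size_iota iter_addr addr0 natz.
have -> : zip (k :: ks) (block_heads b (k :: ks)) =
  (k, b) :: zip ks (block_heads (b + k.+1) ks) by [].
rewrite blocks_cons !pot_cat tails heads in_cons => /predU1P[[-> ->]|kc].
  rewrite !mem_seq_pair mem_iota leqnn addnS ltnS leq_addr /= !eqxx; lia.
have /block_headsP/= c_gt := mem_zip_heads kc.
have c_new (t t' : bool) : ((c, t) \in [seq (j, t') | j <- iota b k.+1]) = false.
  by rewrite mem_seq_pair mem_iota; lia.
rewrite -(IHks _ _ _ kc) !c_new; ring.
Qed.

Lemma wf_block_diagram ks : wf (block_diagram ks).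
Proof.
split; first exact: blocks_uniq.
by move=> [j t]; rewrite /= !mem_blocks.
Qed.

Lemma singular_block_diagram ks :
  singular (block_diagram ks) (block_heads 0 ks).
Proof.
split; first exact: wf_block_diagram.
split; first exact: block_heads_uniq.
split=> [c /block_headsP cS|]; last by apply/allP.
by rewrite -(mem_gword c true (wf_block_diagram ks)) mem_blocks.
Qed.

Lemma Ind_block_diagram ks :
  {in zip ks (block_heads 0 ks), forall p,
    Ind (block_diagram ks) p.2 = - p.1%:Z}.
Proof.
move=> [k c] kc; have [wfD [_ [SD _]]] := singular_block_diagram ks.
rewrite Ind_gpot ?SD ?(mem_zip_heads kc) //.
apply: (blocks_pot (e := esign (block_diagram ks)) _ kc).
by move=> p; rewrite /esign /wr /= mul1r.
Qed.

Lemma jump_ge0 k x : 0 <= jump k x.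
Proof. by rewrite addr_ge0 ?ler0n. Qed.

Theorem theorem3p7 (xs : seq int) :
  (0 < size xs)%N ->
  all (fun x => x != 0%R) xs ->
  sorted (fun x y => (y < x)%R) xs ->
  virtual_invariant (a_inv xs) /\ finite_type_degree (a_inv xs) (size xs).
Proof.
move=> _ xs0 _; split; first exact: a_inv_invariant.
split=> [D S [wfD [uS [SD sS]]] szS|].
  rewrite (ext_a_inv (delta := fun c => jump (Ind D c))) //.
  by rewrite prod_diff_eq0 // size_map szS.
(* The first chord of the block built for [x] has index [- |x|], which is [x] up to sign. *)
pose ks := [seq `|x|%N | x <- xs]; have singD := singular_block_diagram ks.
exists (block_diagram ks), (block_heads 0 ks).
split=> //; split; first by rewrite size_block_heads size_map.
case: singD => wfD [uS [SD sS]].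
rewrite (ext_a_inv (delta := fun c => jump (Ind (block_diagram ks) c))) //.
apply/eqP; rewrite gt_eqF //; apply: prod_diff_gt0 => [c x|]; first exact: jump_ge0.
rewrite all2E size_block_heads !size_map eqxx /=.
have: all (fun p => Ind (block_diagram ks) p.2 == - p.1%:Z) (zip ks (block_heads 0 ks)).
  by apply/allP => p /Ind_block_diagram->.
(* The diagram depends on [xs], so it is generalized before the induction. *)
move: (block_diagram ks) {wfD uS SD sS} => D; rewrite /ks.
elim: xs (block_heads 0 _) {xs0 ks} => [|x xs IHxs] [|c S] //=.
case/andP=> /eqP IndE /IHxs->; rewrite andbT IndE /jump opprK.
(* One of the two indicators in [jump] equals 1, chosen by the sign of [x]. *)
by case: (lerP 0 x) => x0; [rewrite gez0_abs // | rewrite ltz0_abs // opprK];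
  rewrite eqxx /=; case: (_ == x).
Qed.
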